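(* Let $1\to N\to G\to H\to 1$ be an extension of finite groups with $N$ perfect. If the induced map $M_0(G)\to M_0(H)$ is an epimorphism, then the sequence of induced maps $$1\to B_0(H)\to B_0(G)\to B_0(N)$$ is exact.
   Context: For a finite group $G$, the Bogomolov multiplier is $B_0(G)=\operatorname{Ker}\{H^2(G,\mathbb{Q}/\mathbb{Z})\to\bigoplus_A H^2(A,\mathbb{Q}/\mathbb{Z})\}$ (restriction maps, trivial action on $\mathbb{Q}/\mathbb{Z}$), where $A$ runs over all abelian subgroups of $G$. It is functorial: $B_0(H)\to B_0(G)$ and $B_0(G)\to B_0(N)$ are induced by $G\to H$ and $N\to G$. Write ${}^{g}g'=gg'g^{-1}$ and $[g,g']=gg'g^{-1}g'^{-1}$. The tensor square $G\otimes G$ is the group generated by symbols $g\otimes h$ ($g,h\in G$) with relations $gg'\otimes h=({}^{g}g'\otimes {}^{g}h)(g\otimes h)$ and $g\otimes hh'=(g\otimes h)({}^{h}g\otimes {}^{h}h')$. The exterior square $G\wedge G$ is the quotient of $G\otimes G$ by the normal subgroup generated by the elements $g\otimes g$, and $g\wedge h$ denotes the image of $g\otimes h$. $M_0(G)$ is the subgroup of $G\wedge G$ generated by all $x\wedge y$ with $[x,y]=1$; a homomorphism $G\to H$ induces $M_0(G)\to M_0(H)$, $x\wedge y\mapsto$ the wedge of the images. The Schur multiplier is identified with $M(G)=\operatorname{Ker}(G\wedge G\to[G,G],\ g\wedge h\mapsto[g,h])$, and one has the (known, natural) isomorphism $B_0(G)\cong\operatorname{Hom}(M(G)/M_0(G),\mathbb{Q}/\mathbb{Z})$.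 *)

(* Defs.v *)
From HB Require Import structures.
From mathcomp Require Import all_boot all_order all_algebra all_fingroup.
From mathcomp Require Import generic_quotient ring_quotient boolp.

Set Implicit Arguments.
Unset Strict Implicit.
Unset Printing Implicit Defensive.

Import GRing.Theory.

Local Open Scope quotient_scope.

Section MultiplicativeTheory.
Local Open Scope group_scope.
Variables (G H : groupType) (f : {multiplicative G -> H}).

Lemma mulf1 : f 1 = 1.
Proof. by apply: (@mulgI _ (f 1)); rewrite -gmulfM !mulg1. Qed.

Lemma mulfV x : f x^-1 = (f x)^-1.
Proof. by apply: (@mulgI _ (f x)); rewrite -gmulfM !mulgV mulf1. Qed.

End MultiplicativeTheory.

HB.instance Definition _ (gT : finGroupType) (A : {group gT}) :=
  isMultiplicative.Build [subg A] gT (@sgval gT A) (fun _ _ => erefl).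

Lemma subrACA (V : zmodType) (a b c d : V) :
  (a - b - (c - d) = a - c - (b - d))%R.
Proof. by rewrite !opprD addrACA. Qed.

Definition rat_int : {pred rat} := [pred q : rat | q \is a Num.int].

Lemma rat_int_closed : zmod_closed rat_int.
Proof. by split=> [|x y xZ yZ]; rewrite inE ?rpred0 ?rpredB. Qed.

HB.instance Definition _ := GRing.isZmodClosed.Build rat rat_int rat_int_closed.

Definition QmodZ : zmodType := Quotient.quot rat_int.

(* H^2(G, M) by inhomogeneous cochains, for the trivial action of G on M. *)
Section SecondCohomology.
Local Open Scope ring_scope.
Variables (M : zmodType) (G : finGroupType).

Definition cocycle2 : {pred {ffun G * G -> M}} := fun c =>
  [forall x, forall y, forall z,
     c (y, z) - c ((x * y)%g, z) + c (x, (y * z)%g) - c (x, y) == 0].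

Lemma cocycle2P (c : {ffun G * G -> M}) :
  reflect (forall x y z,
             c (y, z) - c ((x * y)%g, z) + c (x, (y * z)%g) - c (x, y) = 0)
          (c \in cocycle2).
Proof.
apply: (iffP forallP) => [cP x y z | cP x].
  by have /forallP/(_ y)/forallP/(_ z)/eqP := cP x.
by apply/forallP => y; apply/forallP => z; apply/eqP.
Qed.

Lemma cocycle2_closed : zmod_closed cocycle2.
Proof.
split=> [|c d /cocycle2P cP /cocycle2P dP]; apply/cocycle2P => x y z.
  by rewrite !ffunE !subr0 addr0.
by rewrite !ffunE subrACA addrACA -opprD subrACA cP dP subrr.
Qed.

HB.instance Definition _ :=
  GRing.isZmodClosed.Build {ffun G * G -> M} cocycle2 cocycle2_closed.

Record Z2 : predArgType := MkZ2 {
  Z2_val : {ffun G * G -> M};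
  Z2_valP : Z2_val \in cocycle2
}.
HB.instance Definition _ := [isSub for Z2_val].
HB.instance Definition _ := [Choice of Z2 by <:].
HB.instance Definition _ := [SubChoice_isSubZmodule of Z2 by <:].

Definition coboundary (phi : {ffun G -> M}) : {ffun G * G -> M} :=
  [ffun p => phi p.2 - phi (p.1 * p.2)%g + phi p.1].

Definition B2 : {pred Z2} := fun c => `[< exists phi, val c = coboundary phi >].

Lemma B2_closed : zmod_closed B2.
Proof.
split=> [|c d /asboolP[phi cE] /asboolP[psi dE]]; apply/asboolP.
  exists 0; apply/ffunP => p.
  by rewrite raddf0 !ffunE subrr addr0.
exists (phi - psi); apply/ffunP => p.
by rewrite raddfB /= cE dE !ffunE subrACA [RHS]addrACA -opprD.
Qed.

HB.instance Definition _ := GRing.isZmodClosed.Build Z2 B2 B2_closed.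

Definition H2 := Quotient.quot B2.
HB.instance Definition _ := GRing.Zmodule.on H2.
HB.instance Definition _ := ZmodQuotient.on H2.

Lemma H2_eq0 (c : Z2) :
  \pi_H2 c = 0 <-> exists phi, val c = coboundary phi.
Proof.
rewrite -(raddf0 \pi_H2); split=> [/eqP|cP].
  by rewrite -Quotient.idealrBE subr0 => /asboolP.
by apply/eqP; rewrite -Quotient.idealrBE subr0; apply/asboolP.
Qed.

End SecondCohomology.

(* The map induced on H^2 by a homomorphism f : G -> H (inflation when f is
   surjective, restriction when f is injective). *)
Section InducedH2.
Local Open Scope ring_scope.
Variables (M : zmodType) (G H : finGroupType) (f : {multiplicative G -> H}).

Definition pullback2 (c : {ffun H * H -> M}) : {ffun G * G -> M} :=
  [ffun p => c (f p.1, f p.2)].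

Lemma pullback2_cocycle (c : Z2 M H) : pullback2 (val c) \in @cocycle2 M G.
Proof.
apply/cocycle2P => x y z; rewrite !ffunE /= !gmulfM.
exact: (cocycle2P _ (valP c)).
Qed.

Definition Z2_map (c : Z2 M H) : Z2 M G := MkZ2 (pullback2_cocycle c).

Lemma Z2_mapE (c : Z2 M H) p :
  val (Z2_map c) p = val c (f p.1, f p.2).
Proof. exact: ffunE. Qed.

Lemma Z2_map_zmod_morphism : zmod_morphism Z2_map.
Proof. by move=> c d; apply/val_inj/ffunP => p; rewrite !(ffunE, raddfB). Qed.

HB.instance Definition _ :=
  GRing.isZmodMorphism.Build (Z2 M H) (Z2 M G) Z2_map Z2_map_zmod_morphism.

Definition H2_map (a : H2 M H) : H2 M G := \pi_(H2 M G) (Z2_map (repr a)).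

Lemma H2_map_pi (c : Z2 M H) :
  H2_map (\pi_(H2 M H) c) = \pi_(H2 M G) (Z2_map c).
Proof.
apply/eqP; rewrite -subr_eq0 -raddfB -(raddfB Z2_map); apply/eqP/H2_eq0.
have /H2_eq0[phi phiE] : \pi_(H2 M H) (repr (\pi_(H2 M H) c) - c) = 0.
  by rewrite raddfB /= reprK subrr.
exists [ffun x => phi (f x)]; apply/ffunP => p.
by rewrite Z2_mapE phiE !ffunE /= gmulfM.
Qed.

Lemma H2_map_zmod_morphism : zmod_morphism H2_map.
Proof.
move=> a b; rewrite -[a]reprK -[b]reprK.
by rewrite -raddfB !H2_map_pi !raddfB.
Qed.

HB.instance Definition _ :=
  GRing.isZmodMorphism.Build (H2 M H) (H2 M G) H2_map H2_map_zmod_morphism.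

End InducedH2.

Section Bogomolov.
Local Open Scope ring_scope.
Variable G : finGroupType.

Definition H2_res (A : {group G}) : H2 QmodZ G -> H2 QmodZ [subg A] :=
  H2_map (@sgval G A).

(* The common kernel of the restrictions to the abelian subgroups, that is, the
   kernel of the map to the direct sum. *)
Definition B0_pred : {pred H2 QmodZ G} :=
  fun a => [forall A : {group G}, abelian A ==> (H2_res A a == 0)].

Lemma B0_predP (a : H2 QmodZ G) :
  reflect (forall A : {group G}, abelian A -> H2_res A a = 0) (a \in B0_pred).
Proof.
apply: (iffP forallP) => [aP A abA | aP A].
  by have /implyP/(_ abA)/eqP := aP A.
by apply/implyP => /aP/eqP.
Qed.

Lemma B0_closed : zmod_closed B0_pred.
Proof.
split=> [|a b /B0_predP aP /B0_predP bP]; apply/B0_predP => A abA.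
  by rewrite /H2_res raddf0.
by rewrite /H2_res raddfB /= [X in X - _]aP // [X in _ - X]bP // subrr.
Qed.

HB.instance Definition _ :=
  GRing.isZmodClosed.Build (H2 QmodZ G) B0_pred B0_closed.

Record B0 : predArgType := MkB0 {
  B0_val : H2 QmodZ G;
  B0_valP : B0_val \in B0_pred
}.
HB.instance Definition _ := [isSub for B0_val].
HB.instance Definition _ := [Choice of B0 by <:].
HB.instance Definition _ := [SubChoice_isSubZmodule of B0 by <:].

End Bogomolov.

Section InducedB0.
Local Open Scope ring_scope.
Variables (G H : finGroupType) (f : {multiplicative G -> H}).

Lemma H2_map_B0 (a : B0 H) : H2_map f (val a) \in @B0_pred G.
Proof.
have fM : {in [set: G] &, {morph f : x y / (x * y)%g}}.
  by move=> x y _ _; apply: gmulfM.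
pose fm := Morphism fM.
apply/B0_predP => A abA; rewrite /H2_res.
have abfA : abelian (fm @* A)%g by apply: morphim_abelian.
have := B0_predP _ (valP a) _ abfA; rewrite /H2_res.
rewrite -[val a]reprK !H2_map_pi => /H2_eq0[phi phiE]; apply/H2_eq0.
have fA (x : [subg A]) : f (sgval x) \in (fm @* A)%g.
  by apply: (mem_morphim fm); rewrite ?inE ?subgP.
exists [ffun x => phi (Subg (fA x))]; apply/ffunP => -[x y].
have /ffunP/(_ (Subg (fA x), Subg (fA y))) := phiE.
rewrite !Z2_mapE !ffunE => /= valE.
rewrite /= reprK {}valE; congr (_ - phi _ + _).
by apply: val_inj; rewrite /= gmulfM.
Qed.

Definition B0_map (a : B0 H) : B0 G := MkB0 (H2_map_B0 a).

Lemma B0_map_zmod_morphism : zmod_morphism B0_map.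
Proof. by move=> a b; apply/val_inj; rewrite /= !raddfB. Qed.

HB.instance Definition _ :=
  GRing.isZmodMorphism.Build (B0 H) (B0 G) B0_map B0_map_zmod_morphism.

End InducedB0.

(* The left-handed conventions ^g g' and [g, g'], as opposed to MathComp's
   x ^ y = y^-1 * x * y and [~ x, y] = x^-1 * y^-1 * x * y. *)
Definition lconjg (G : groupType) (g g' : G) : G := (g * g' * g^-1)%g.
Definition lcommg (G : groupType) (g g' : G) : G := (g * g' * g^-1 * g'^-1)%g.

(* The free group on X: words in the letters (x, true) for x and (x, false)
   for its inverse, modulo the congruence generated by cancellation. *)
Section FreeGroup.
Local Open Scope group_scope.
Variable X : choiceType.

Inductive fg_cong : seq (X * bool) -> seq (X * bool) -> Prop :=
| fg_refl u : fg_cong u u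
| fg_sym u v : fg_cong u v -> fg_cong v u
| fg_trans u v w : fg_cong u v -> fg_cong v w -> fg_cong u w
| fg_cat u u' v v' : fg_cong u u' -> fg_cong v v' -> fg_cong (u ++ v) (u' ++ v')
| fg_cancel x b : fg_cong [:: (x, b); (x, ~~ b)] [::].

Definition fg_rel (u v : seq (X * bool)) : bool := `[< fg_cong u v >].

Lemma fg_rel_equiv : equiv_class_of fg_rel.
Proof.
split=> [u|u v|v u w]; first exact/asboolP/fg_refl.
  by apply/asboolP/asboolP; apply: fg_sym.
by move=> /asboolP uv /asboolP vw; apply/asboolP/(fg_trans uv vw).
Qed.

Canonical fg_equiv := EquivRelPack fg_rel_equiv.
Canonical fg_encModRel := defaultEncModRel fg_rel.

Definition free_group := {eq_quot fg_rel}.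
HB.instance Definition _ := Choice.on free_group.
HB.instance Definition _ := EqQuotient.on free_group.

Lemma fg_piP u v : fg_cong u v <-> \pi_free_group u = \pi_free_group v.
Proof.
split=> [uv|/eqP]; first by apply/eqP; rewrite piE; apply/asboolP.
by rewrite piE => /asboolP.
Qed.

Definition fg_letter_inv (l : X * bool) : X * bool := (l.1, ~~ l.2).
Definition fg_word_inv (u : seq (X * bool)) : seq (X * bool) :=
  rev (map fg_letter_inv u).

Lemma fg_word_invK : involutive fg_word_inv.
Proof.
move=> u; rewrite /fg_word_inv map_rev revK -map_comp map_id_in // => -[x b] _.
by rewrite /fg_letter_inv /= negbK.
Qed.

Lemma fg_word_inv_cong u v :
  fg_cong u v -> fg_cong (fg_word_inv u) (fg_word_inv v).
Proof.
elim=> {u v} [u|u v _|u v w _ uv _|u u' v v' _ uu _ vv|x b].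
- exact: fg_refl.
- exact: fg_sym.
- exact: fg_trans uv.
- by rewrite /fg_word_inv !map_cat !rev_cat; apply: fg_cat.
- by rewrite /fg_word_inv /rev /fg_letter_inv /= negbK; apply: fg_cancel.
Qed.

Lemma fg_word_mulVw u : fg_cong (fg_word_inv u ++ u) [::].
Proof.
elim: u => [|[x b] u IHu]; first exact: fg_refl.
rewrite /fg_word_inv map_cons rev_cons -cats1 -catA /=.
apply: fg_trans IHu; apply: fg_cat; first exact: fg_refl.
rewrite -[in X in fg_cong _ X](cat0s u) -(cat1s _ (_ :: u)) -(cat1s _ u) catA.
apply: fg_cat; last exact: fg_refl.
by have := fg_cancel x (~~ b); rewrite negbK.
Qed.

Definition fg_one : free_group := \pi_free_group [::].
Definition fg_mul (a b : free_group) : free_group :=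
  \pi_free_group (repr a ++ repr b).
Definition fg_inv (a : free_group) : free_group :=
  \pi_free_group (fg_word_inv (repr a)).

Lemma fg_repr_pi u : fg_cong (repr (\pi_free_group u)) u.
Proof. by apply/fg_piP; rewrite reprK. Qed.

Lemma fg_mul_pi u v :
  fg_mul (\pi_free_group u) (\pi_free_group v) = \pi_free_group (u ++ v).
Proof. by apply/fg_piP/fg_cat; apply: fg_repr_pi. Qed.

Lemma fg_inv_pi u :
  fg_inv (\pi_free_group u) = \pi_free_group (fg_word_inv u).
Proof. by apply/fg_piP/fg_word_inv_cong/fg_repr_pi. Qed.

Lemma fg_mulA : associative fg_mul.
Proof.
elim/quotW=> x; elim/quotW=> y; elim/quotW=> z.
by rewrite (fg_mul_pi y z) fg_mul_pi (fg_mul_pi x y) fg_mul_pi catA.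
Qed.

Lemma fg_mul1 : left_id fg_one fg_mul.
Proof. by elim/quotW=> x; rewrite fg_mul_pi. Qed.

Lemma fg_mul1r : right_id fg_one fg_mul.
Proof. by elim/quotW=> x; rewrite fg_mul_pi cats0. Qed.

Lemma fg_mulV : left_inverse fg_one fg_inv fg_mul.
Proof.
elim/quotW=> u; rewrite fg_inv_pi fg_mul_pi.
exact/fg_piP/fg_word_mulVw.
Qed.

Lemma fg_mulVr : right_inverse fg_one fg_inv fg_mul.
Proof.
elim/quotW=> u; rewrite fg_inv_pi fg_mul_pi.
apply/fg_piP; rewrite -{1}(fg_word_invK u); exact: fg_word_mulVw.
Qed.

HB.instance Definition _ :=
  isGroup.Build free_group fg_mulA fg_mul1 fg_mul1r fg_mulV fg_mulVr.

Definition fg_gen (x : X) : free_group := \pi_free_group [:: (x, true)].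

Section Lift.
Variables (K : groupType) (f : X -> K).

Definition fg_eval (u : seq (X * bool)) : K :=
  \prod_(l <- u) (if l.2 then f l.1 else (f l.1)^-1).

Lemma fg_eval_cong u v : fg_cong u v -> fg_eval u = fg_eval v.
Proof.
elim=> {u v} [//|u v _ //|u v w _ -> _ //|u u' v v' _ uu _ vv|x b].
  by rewrite /fg_eval !big_cat /= -/(fg_eval u) -/(fg_eval v) uu vv.
by rewrite /fg_eval !big_cons big_nil; case: b; rewrite /= mulg1 ?mulgV ?mulVg.
Qed.

Definition fg_lift (a : free_group) : K := fg_eval (repr a).

Lemma fg_lift_pi u : fg_lift (\pi_free_group u) = fg_eval u.
Proof. exact/fg_eval_cong/fg_repr_pi. Qed.

Lemma fg_lift_gen x : fg_lift (fg_gen x) = f x.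
Proof. by rewrite fg_lift_pi /fg_eval big_seq1. Qed.

Lemma fg_liftM : {morph fg_lift : a b / a * b}.
Proof.
elim/quotW=> u; elim/quotW=> v; rewrite [_ * _]fg_mul_pi !fg_lift_pi.
exact: big_cat.
Qed.

HB.instance Definition _ := isMultiplicative.Build free_group K fg_lift fg_liftM.

End Lift.

End FreeGroup.

(* The quotient of a group by the normal subgroup generated by a subset S. *)
Section NormalClosureQuotient.
Local Open Scope group_scope.
Variables (K : groupType) (S : K -> Prop).

Inductive normal_closure : K -> Prop :=
| ncl_mem x : S x -> normal_closure x
| ncl1 : normal_closure 1
| nclM x y : normal_closure x -> normal_closure y -> normal_closure (x * y)
| nclV x : normal_closure x -> normal_closure x^-1
| nclJ x y : normal_closure x -> normal_closure (x ^ y).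

Definition ncl_rel (x y : K) : bool := `[< normal_closure (x * y^-1) >].

Lemma ncl_rel_equiv : equiv_class_of ncl_rel.
Proof.
have sym x y : ncl_rel x y -> ncl_rel y x.
  by move=> /asboolP/nclV xy; apply/asboolP; rewrite invMg invgK in xy.
split=> [x|x y|y x z]; first by apply/asboolP; rewrite mulgV; apply: ncl1.
  by apply/idP/idP; apply: sym.
move=> /asboolP xy /asboolP yz; apply/asboolP.
by have := nclM xy yz; rewrite mulgA mulgVK.
Qed.

Canonical ncl_equiv := EquivRelPack ncl_rel_equiv.
Canonical ncl_encModRel := defaultEncModRel ncl_rel.

Definition ncl_quot := {eq_quot ncl_rel}.
HB.instance Definition _ := Choice.on ncl_quot.
HB.instance Definition _ := EqQuotient.on ncl_quot.

Lemma ncl_piP x y :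
  normal_closure (x * y^-1) <-> \pi_ncl_quot x = \pi_ncl_quot y.
Proof.
split=> [xy|/eqP]; first by apply/eqP; rewrite piE; apply/asboolP.
by rewrite piE => /asboolP.
Qed.

Definition nq_one : ncl_quot := \pi_ncl_quot 1.
Definition nq_mul (a b : ncl_quot) : ncl_quot := \pi_ncl_quot (repr a * repr b).
Definition nq_inv (a : ncl_quot) : ncl_quot := \pi_ncl_quot (repr a)^-1.

Lemma nq_repr_pi x : normal_closure (repr (\pi_ncl_quot x) * x^-1).
Proof. by apply/ncl_piP; rewrite reprK. Qed.

Lemma nq_mul_pi x y :
  nq_mul (\pi_ncl_quot x) (\pi_ncl_quot y) = \pi_ncl_quot (x * y).
Proof.
apply/ncl_piP; set x' := repr _; set y' := repr _.
have -> : x' * y' * (x * y)^-1 = (x' * x^-1) * (y' * y^-1) ^ x^-1.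
  by rewrite /conjg invgK invMg !mulgA mulgVK.
by apply: nclM; [|apply: nclJ]; apply: nq_repr_pi.
Qed.

Lemma nq_inv_pi x : nq_inv (\pi_ncl_quot x) = \pi_ncl_quot x^-1.
Proof.
apply/ncl_piP; rewrite invgK; set x' := repr _.
have -> : x'^-1 * x = (x' * x^-1)^-1 ^ x.
  by rewrite /conjg invMg invgK !mulgA mulVg mul1g.
exact/nclJ/nclV/nq_repr_pi.
Qed.

Lemma nq_mulA : associative nq_mul.
Proof.
elim/quotW=> x; elim/quotW=> y; elim/quotW=> z.
by rewrite (nq_mul_pi y z) nq_mul_pi (nq_mul_pi x y) nq_mul_pi mulgA.
Qed.

Lemma nq_mul1 : left_id nq_one nq_mul.
Proof. by elim/quotW=> x; rewrite nq_mul_pi mul1g. Qed.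

Lemma nq_mul1r : right_id nq_one nq_mul.
Proof. by elim/quotW=> x; rewrite nq_mul_pi mulg1. Qed.

Lemma nq_mulV : left_inverse nq_one nq_inv nq_mul.
Proof. by elim/quotW=> x; rewrite nq_inv_pi nq_mul_pi mulVg. Qed.

Lemma nq_mulVr : right_inverse nq_one nq_inv nq_mul.
Proof. by elim/quotW=> x; rewrite nq_inv_pi nq_mul_pi mulgV. Qed.

HB.instance Definition _ :=
  isGroup.Build ncl_quot nq_mulA nq_mul1 nq_mul1r nq_mulV nq_mulVr.

Definition nq_proj (x : K) : ncl_quot := \pi_ncl_quot x.

Lemma nq_projM : {morph nq_proj : x y / x * y}.
Proof. by move=> x y; rewrite [RHS]nq_mul_pi. Qed.

HB.instance Definition _ := isMultiplicative.Build K ncl_quot nq_proj nq_projM.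

Lemma nq_proj_mem x : S x -> nq_proj x = 1.
Proof. by move=> Sx; apply/ncl_piP; rewrite invg1 mulg1; apply: ncl_mem. Qed.

Lemma nq_proj_rel x y : S (x * y^-1) -> nq_proj x = nq_proj y.
Proof. by move=> Sxy; apply/ncl_piP/ncl_mem. Qed.

Section Lift.
Variables (L : groupType) (f : {multiplicative K -> L}).
Hypothesis fS : forall x, S x -> f x = 1.

Lemma normal_closure_ker x : normal_closure x -> f x = 1.
Proof.
elim=> {x} [x /fS//||x y _ fx _ fy|x _ fx|x y _ fx].
- exact: mulf1.
- by rewrite gmulfM fx fy mulg1.
- by rewrite mulfV fx invg1.
- by rewrite !gmulfM fx mul1g -gmulfM mulVg mulf1.
Qed.

Definition nq_lift of (forall x, S x -> f x = 1) :=
  fun a : ncl_quot => f (repr a).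

Lemma nq_lift_proj x : nq_lift fS (nq_proj x) = f x.
Proof.
apply: (@mulIg _ (f x)^-1); rewrite mulgV -mulfV -gmulfM.
exact/normal_closure_ker/nq_repr_pi.
Qed.

Lemma nq_liftM : {morph nq_lift fS : a b / a * b}.
Proof.
elim/quotW=> x; elim/quotW=> y; rewrite -/(nq_proj x) -/(nq_proj y).
by rewrite -gmulfM !nq_lift_proj gmulfM.
Qed.

HB.instance Definition _ :=
  isMultiplicative.Build ncl_quot L (nq_lift fS) nq_liftM.

End Lift.

End NormalClosureQuotient.

Section ExteriorSquare.
Local Open Scope group_scope.
Variable G : groupType.

Definition symbols : choiceType := (G * G)%type.

Definition symbol (g h : G) : free_group symbols := @fg_gen symbols (g, h).

(* A relation a = b is encoded by the relator a * b^-1. *)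
Inductive tensor_relator : free_group symbols -> Prop :=
| tensor_relMl g g' h :
    tensor_relator (symbol (g * g') h *
                    (symbol (lconjg g g') (lconjg g h) * symbol g h)^-1)
| tensor_relMr g h h' :
    tensor_relator (symbol g (h * h') *
                    (symbol g h * symbol (lconjg h g) (lconjg h h'))^-1).

Definition tensor_square := ncl_quot tensor_relator.
HB.instance Definition _ := Group.on tensor_square.

Definition tensor (g h : G) : tensor_square :=
  nq_proj tensor_relator (symbol g h).

Lemma tensorMl g g' h :
  tensor (g * g') h = tensor (lconjg g g') (lconjg g h) * tensor g h.
Proof. by rewrite -gmulfM; apply: nq_proj_rel; apply: tensor_relMl. Qed.

Lemma tensorMr g h h' :
  tensor g (h * h') = tensor g h * tensor (lconjg h g) (lconjg h h').
Proof. by rewrite -gmulfM; apply: nq_proj_rel; apply: tensor_relMr. Qed.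

Inductive tensor_diag : tensor_square -> Prop :=
| Tensor_diag g : tensor_diag (tensor g g).

Definition exterior_square := ncl_quot tensor_diag.
HB.instance Definition _ := Group.on exterior_square.

Definition wedge (g h : G) : exterior_square :=
  nq_proj tensor_diag (tensor g h).

Lemma wedge_diag g : wedge g g = 1.
Proof. exact: nq_proj_mem (Tensor_diag g). Qed.

End ExteriorSquare.

Section GeneratedSubgroup.
Local Open Scope group_scope.
Variables (K : groupType) (S : K -> Prop).

Inductive generated : K -> Prop :=
| gen_mem x : S x -> generated x
| gen1 : generated 1
| genM x y : generated x -> generated y -> generated (x * y)
| genV x : generated x -> generated x^-1.

End GeneratedSubgroup.

Section M0.
Local Open Scope group_scope.
Variable G : groupType.

Inductive commuting_wedge : exterior_square G -> Prop :=
| Commuting_wedge x y : lcommg x y = 1 -> commuting_wedge (wedge x y).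

Definition M0_pred : {pred exterior_square G} :=
  fun w => `[< generated commuting_wedge w >].

Lemma M0_closed : group_closed M0_pred.
Proof.
split=> [|v w /asboolP M0v /asboolP M0w]; apply/asboolP; first exact: gen1.
exact/genM/genV.
Qed.

Record M0 : predArgType := MkM0 {
  M0_val : exterior_square G;
  M0_valP : M0_val \in M0_pred
}.
HB.instance Definition _ := [isSub for M0_val].
HB.instance Definition _ := [Choice of M0 by <:].
HB.instance Definition _ := SubChoice_isSubGroup.Build _ _ M0 M0_closed.

End M0.

Section InducedM0.
Local Open Scope group_scope.
Variables (G H : groupType) (f : {multiplicative G -> H}).

Lemma mulf_conj g g' : f (lconjg g g') = lconjg (f g) (f g').
Proof. by rewrite /lconjg !gmulfM mulfV. Qed.

Lemma mulf_comm g g' : f (lcommg g g') = lcommg (f g) (f g').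
Proof. by rewrite /lcommg !gmulfM !mulfV. Qed.

Definition free_tensor_map : free_group (symbols G) -> tensor_square H :=
  fg_lift (fun p : symbols G => tensor (f p.1) (f p.2)).
HB.instance Definition _ := Multiplicative.on free_tensor_map.

Lemma free_tensor_map_symbol g h :
  free_tensor_map (symbol g h) = tensor (f g) (f h).
Proof. exact: fg_lift_gen. Qed.

Lemma free_tensor_map_rel a : tensor_relator a -> free_tensor_map a = 1.
Proof.
case=> [g g' h|g h h']; rewrite gmulfM mulfV gmulfM /= !free_tensor_map_symbol.
  by rewrite gmulfM tensorMl !mulf_conj mulgV.
by rewrite gmulfM tensorMr !mulf_conj mulgV.
Qed.

Definition tensor_map : tensor_square G -> tensor_square H :=
  nq_lift free_tensor_map_rel.
HB.instance Definition _ := Multiplicative.on tensor_map.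

Lemma tensor_mapE g h : tensor_map (tensor g h) = tensor (f g) (f h).
Proof. by rewrite [LHS]nq_lift_proj /= free_tensor_map_symbol. Qed.

Definition tensor_wedge_map : tensor_square G -> exterior_square H :=
  nq_proj (@tensor_diag H) \o tensor_map.
HB.instance Definition _ := Multiplicative.on tensor_wedge_map.

Lemma tensor_wedge_map_diag a : tensor_diag a -> tensor_wedge_map a = 1.
Proof. by case=> g; rewrite /tensor_wedge_map /= tensor_mapE; apply: wedge_diag. Qed.

Definition exterior_map : exterior_square G -> exterior_square H :=
  nq_lift tensor_wedge_map_diag.
HB.instance Definition _ := Multiplicative.on exterior_map.

Lemma exterior_mapE g h : exterior_map (wedge g h) = wedge (f g) (f h).
Proof. by rewrite [LHS]nq_lift_proj /= /tensor_wedge_map /= tensor_mapE. Qed.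

Lemma exterior_map_M0 (w : M0 G) : exterior_map (val w) \in @M0_pred H.
Proof.
have /asboolP := valP w; move: (val w) => {}w wP; apply/asboolP.
elim: wP => {w} [_ [x y xy1]||v w _ IHv _ IHw|v _ IHv].
- rewrite exterior_mapE; apply/gen_mem/Commuting_wedge.
  by rewrite -mulf_comm xy1 mulf1.
- by rewrite mulf1; apply: gen1.
- by rewrite gmulfM; apply: genM.
- by rewrite mulfV; apply: genV.
Qed.

Definition M0_map (w : M0 G) : M0 H := MkM0 (exterior_map_M0 w).

Lemma M0_mapM : {morph M0_map : v w / v * w}.
Proof. by move=> v w; apply/val_inj; rewrite /= !gmulfM. Qed.

HB.instance Definition _ := isMultiplicative.Build (M0 G) (M0 H) M0_map M0_mapM.

End InducedM0.

(* Main.v *)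
Require Import Defs.
From HB Require Import structures.
From mathcomp Require Import all_boot all_order all_algebra all_fingroup cyclic.
From mathcomp Require Import generic_quotient ring_quotient boolp.

Set Implicit Arguments.
Unset Strict Implicit.
Unset Printing Implicit Defensive.

(** Write [c'] for a normalised form of a 2-cocycle [c], that is, the
    difference of [c] and a coboundary.

    As [N] is perfect, every homomorphism from [N] to a commutative group is
    trivial, and this kills all the obstructions in the low degree part of the
    inflation-restriction sequence.  If the inflation to [G] of a cocycle of [H]
    is the coboundary of [phi], then [phi] is, up to a constant, a homomorphism
    on [N]; so [phi] is constant on the cosets of [N] and descends to [H]
    ([inflation_inj]).  If a class of [G] restricts to zero on [N], choosing a
    transversal normalises a representing cocycle to a [c'] with
    [c' (g, n) = 0] for [n] in [N] ([normalize_cosets]); then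
    [n |-> c' (n, g)] is a homomorphism, hence zero, and [c'] is constant on
    cosets, so that the class is inflated from [H] ([inflation_exact]).

    It remains to see that this class of [H] lies in [B0 H] when the given one
    lies in [B0 G].  The class of [c] is in the Bogomolov multiplier if and only
    if [c (x, y) = c (y, x)] whenever [x] and [y] commute ([B0_piP]); here the
    divisibility of Q/Z enters, to split the symmetric cocycles of abelian
    groups ([symmetric_coboundary]).  In the central extension of [H] defined by
    a cocycle [d], the commutator of lifts of [x] and [y] only depends on [x]
    and [y], so that it defines a homomorphism on the exterior square of [H]
    ([wedge_commutator_map]); for commuting [x] and [y] its value at the wedge
    of [x] and [y] measures [d (x, y) - d (y, x)].  If the inflation of [d] is
    symmetric on commuting pairs, the homomorphism vanishes on the image of
    [M0 G], which is all of [M0 H] by hypothesis; so [d] is symmetric on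
    commuting pairs as well ([symmetric_on_commuting_descent]). *)

Import GRing.Theory.

Local Open Scope quotient_scope.
Local Open Scope ring_scope.
Local Open Scope group_scope.

(** * Identities in commutative groups *)

Lemma eq_of_subr_eq0 (V : zmodType) (x y : V) : 0 + (x - y) == 0 -> x = y.
Proof. by rewrite add0r subr_eq0 => /eqP. Qed.

Lemma eq_of_subr_eq (V : zmodType) (x y l r : V) :
  l = r -> x - y = l - r -> x = y.
Proof. by move=> ->; rewrite subrr => /eqP; rewrite subr_eq0 => /eqP. Qed.

(** Moves the opposite of the last term next to it and cancels both, until
    nothing is left.  The terms of either sign must be pairwise distinct, for a
    repeated term would be exchanged with itself forever. *)
Ltac zcancel :=
  apply: eq_of_subr_eq0; rewrite !(opprD, opprK, oppr0, addr0, addrA);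
  repeat match goal with
  | |- is_true (?s + - ?a == _) => rewrite ?(addrAC _ a) addrNK
  | |- is_true (?s + ?a == _) => rewrite ?(addrAC _ (- a)) addrK
  end;
  rewrite ?eqxx; try done.

(** Deduces an equality from the equality [h], when the difference of the two
    sides is the same in both. *)
Ltac zcancel_by h := apply: (eq_of_subr_eq h); zcancel.

(** * Cocycles and coboundaries *)

Section CocycleCalculus.
Variables (M : zmodType) (G : finGroupType).
Implicit Types (c : Z2 M G) (phi : {ffun G -> M}).

Lemma cocycleE c x y z :
  val c (y, z) + val c (x, y * z) = val c (x * y, z) + val c (x, y).
Proof. have /cocycle2P/(_ x y z) h := valP c; zcancel_by h. Qed.

Lemma cocyclex1 c x : val c (x, 1) = val c (1, 1).
Proof.
by have := cocycleE c x 1 1; rewrite !mulg1 => h; zcancel_by (esym h).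
Qed.

Lemma cocycle1x c x : val c (1, x) = val c (1, 1).
Proof. by have := cocycleE c 1 1 x; rewrite !mul1g => h; zcancel_by h. Qed.

Lemma cocycle_invC c x : val c (x, x^-1) = val c (x^-1, x).
Proof.
have := cocycleE c x x^-1 x; rewrite mulgV mulVg cocyclex1 cocycle1x => h.
zcancel_by (esym h).
Qed.

Lemma coboundaryE phi x y :
  coboundary phi (x, y) = phi y - phi (x * y) + phi x.
Proof. exact: ffunE. Qed.

Lemma coboundary_cocycle phi : coboundary phi \in @cocycle2 M G.
Proof. by apply/cocycle2P => x y z; rewrite !coboundaryE mulgA; zcancel. Qed.

Definition coboundary_Z2 phi : Z2 M G := MkZ2 (coboundary_cocycle phi).

Lemma subr_coboundaryE c phi x y :
  val (c - coboundary_Z2 phi) (x, y) =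
  val c (x, y) - (phi y - phi (x * y) + phi x).
Proof. by rewrite raddfB /= !ffunE. Qed.

Lemma H2_subr_coboundary c phi :
  \pi_(H2 M G) (c - coboundary_Z2 phi) = \pi_(H2 M G) c.
Proof.
apply/eqP; rewrite -subr_eq0 -raddfB; apply/eqP/H2_eq0.
exists (- phi); apply/ffunP => -[x y].
by rewrite !(raddfB, ffunE) /=; zcancel.
Qed.

End CocycleCalculus.

(** * Descent of cocycles to a quotient group *)

Section Descent.
Variables (M : zmodType) (G H : finGroupType) (p : {multiplicative G -> H}).

(** Once the cocycle vanishes on the kernel, add to it the coboundary of
    [t n |-> c (t, n)], for [t] in a set of coset representatives and [n] in the
    kernel.  In the extension defined by [c], this replaces the lift of [t n] by
    the product of the lifts of [t] and [n], so that multiplying a lift on the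
    right by the lift of an element of the kernel gives a lift. *)
Lemma normalize_cosets (c : Z2 M G) phi :
    (forall m n, p m = 1 -> p n = 1 -> val c (m, n) = coboundary phi (m, n)) ->
  exists psi, forall g n, p n = 1 -> val (c - coboundary_Z2 psi) (g, n) = 0.
Proof.
move=> cphi; pose c1 := c - coboundary_Z2 phi.
have c10 m n : p m = 1 -> p n = 1 -> val c1 (m, n) = 0.
  by move=> pm pn; rewrite raddfB /= !ffunE -coboundaryE cphi // subrr.
pose t h := odflt 1 [pick x | p x == h].
have pt g : p (t (p g)) = p g.
  by rewrite /t; case: pickP => [x /eqP//|/(_ g)]; rewrite eqxx.
pose r g := t (p g).
have pr g : p ((r g)^-1 * g) = 1 by rewrite gmulfM Defs.mulfV pt mulVg.
pose phi2 := [ffun g => val c1 (r g, (r g)^-1 * g)].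
have phi2_ker n : p n = 1 -> phi2 n = 0.
  by move=> pn; rewrite ffunE c10 // pt.
exists (phi - phi2) => g n pn.
have pgn : r (g * n) = r g by rewrite /r gmulfM pn mulg1.
have := cocycleE c1 (r g) ((r g)^-1 * g) n.
rewrite c10 // mulVKg.
(* The cocycle identity reads [c1 (g, n) = phi2 (g n) - phi2 g]. *)
have := phi2_ker n pn.
have -> : val c1 (r g, (r g)^-1 * g * n) = phi2 (g * n).
  by rewrite [RHS]ffunE pgn mulgA.
have -> : val c1 (r g, (r g)^-1 * g) = phi2 g by rewrite [RHS]ffunE.
rewrite /c1 !subr_coboundaryE !ffunE.
move: (phi2 n) (phi2 (g * n)) (phi2 g) => a b d -> h.
zcancel_by (esym h).
Qed.

Hypothesis p_surj : forall h, exists g, p g = h.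

(** The cocycle identity turns the vanishing at the elements of the kernel into
    invariance under right multiplication of either argument by the kernel. *)
Lemma descend_cocycle (c : Z2 M G) :
    (forall g n, p n = 1 -> val c (g, n) = 0 /\ val c (n, g) = 0) ->
  exists d : Z2 M H, Z2_map p d = c.
Proof.
move=> c0.
have ker_div x y : p x = p y -> p (x^-1 * y) = 1.
  by move=> pxy; rewrite gmulfM Defs.mulfV pxy mulVg.
have cr x y n : p n = 1 -> val c (x, y * n) = val c (x, y).
  move=> pn; have h := cocycleE c x y n.
  by rewrite !(proj1 (c0 _ n pn)) !add0r in h.
have cl x y n : p n = 1 -> val c (x * n, y) = val c (x, y).
  move=> pn; have h := cocycleE c x n y.
  rewrite (proj1 (c0 _ n pn)) (proj2 (c0 _ n pn)) addr0 add0r in h.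
  have pny : p (y^-1 * (n * y)) = 1.
    by rewrite !gmulfM pn mul1g -gmulfM mulVg mulf1.
  by rewrite -h -(mulVKg y (n * y)) cr.
have s_ex h : {g | p g = h} by apply: cid.
pose s h := sval (s_ex h).
have ps h : p (s h) = h := svalP (s_ex h).
pose d := [ffun q : H * H => val c (s q.1, s q.2)].
have dE x y : d (p x, p y) = val c (x, y).
  rewrite ffunE /= -[in RHS](mulVKg (s (p x)) x) -[in RHS](mulVKg (s (p y)) y).
  by rewrite cr ?cl // ker_div ?ps.
have dP : d \in @cocycle2 M H.
  apply/cocycle2P => x y z.
  rewrite -(ps x) -(ps y) -(ps z) -!gmulfM !dE.
  exact: (cocycle2P _ (valP c)).
by exists (MkZ2 dP); apply/val_inj/ffunP => -[x y]; rewrite Z2_mapE /= dE.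
Qed.

(** The second hypothesis is the part that no choice of coset representatives
    provides: it holds for a perfect kernel, and for symmetric cocycles. *)
Lemma descend_class (c : Z2 M G) phi :
    (forall m n, p m = 1 -> p n = 1 -> val c (m, n) = coboundary phi (m, n)) ->
    (forall psi, let c' := c - coboundary_Z2 psi in
       (forall g n, p n = 1 -> val c' (g, n) = 0) ->
       forall g n, p n = 1 -> val c' (n, g) = 0) ->
  exists d : Z2 M H, exists psi, Z2_map p d = c - coboundary_Z2 psi.
Proof.
move=> /normalize_cosets[psi psiP] /(_ psi psiP) psiP'.
have [d dE] : exists d, Z2_map p d = c - coboundary_Z2 psi.
  by apply: descend_cocycle => g n pn; rewrite psiP ?psiP'.
by exists d, psi.
Qed.

End Descent.

(** * The central extension defined by a cocycle *)

Section CentralExtension.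
Variables (M : zmodType) (G : finGroupType) (c : Z2 M G).

(** The argument lets the group law be inferred from the type.  The lift
    [(0, g)] of [g] is multiplied with twist [c], so that the unit is
    [(- c (1, 1), 1)] in general. *)
Definition central_ext of Z2 M G : Type := (M * G)%type.
HB.instance Definition _ d := Choice.on (central_ext d).
Local Notation E := (central_ext c).

Definition ce_one : E := (- val c (1, 1), 1).
Definition ce_mul (x y : E) : E :=
  (x.1 + y.1 + val c (x.2, y.2), x.2 * y.2).
Definition ce_inv (x : E) : E :=
  (- x.1 - val c (x.2^-1, x.2) - val c (1, 1), x.2^-1).

Lemma ce_mulA : associative ce_mul.
Proof.
move=> x y z; congr (_, _) => /=; last exact: mulgA.
by have h := cocycleE c x.2 y.2 z.2; zcancel_by h.
Qed.

Lemma ce_mul1 : left_id ce_one ce_mul.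
Proof.
by case=> a g; rewrite /ce_mul /= (cocycle1x _ g) mul1g; congr (_, _); zcancel.
Qed.

Lemma ce_mul1r : right_id ce_one ce_mul.
Proof. by case=> a g; rewrite /ce_mul /= (cocyclex1 _ g) mulg1 addrNK. Qed.

Lemma ce_mulV : left_inverse ce_one ce_inv ce_mul.
Proof. by case=> a g; congr (_, _) => /=; [zcancel | exact: mulVg]. Qed.

Lemma ce_mulVr : right_inverse ce_one ce_inv ce_mul.
Proof.
case=> a g; congr (_, _) => /=; last exact: mulgV.
by rewrite cocycle_invC; zcancel.
Qed.

HB.instance Definition _ :=
  isGroup.Build E ce_mulA ce_mul1 ce_mul1r ce_mulV ce_mulVr.

Definition ce_proj (x : E) : G := x.2.
Lemma ce_projM : {morph ce_proj : x y / x * y}. Proof. by []. Qed.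
HB.instance Definition _ :=
  isMultiplicative.Build E G ce_proj ce_projM.

Definition ce_sec (g : G) : E := (0, g).

Lemma ce_mulE (x y : E) :
  x * y = (x.1 + y.1 + val c (x.2, y.2), x.2 * y.2).
Proof. by []. Qed.

Lemma ce_ker_central (z x : E) : ce_proj z = 1 -> commute z x.
Proof.
rewrite /ce_proj => z1; rewrite /commute !ce_mulE z1 mulg1 mul1g cocycle1x.
by rewrite cocyclex1 [z.1 + _]addrC.
Qed.

Lemma ce_sec_commute g h :
  commute g h -> commute (ce_sec g) (ce_sec h) <-> val c (g, h) = val c (h, g).
Proof.
move=> gh; rewrite /commute !ce_mulE /= !add0r gh.
by split=> [[]//|->].
Qed.

(** The shift by [c (1, 1)] makes this a homomorphism, onto the kernel. *)
Definition ce_inj (m : M) : E := (m - val c (1, 1), 1).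

Lemma ce_injD m n : ce_inj (m + n) = ce_inj m * ce_inj n.
Proof.
by rewrite ce_mulE /= mulg1; congr (_, _); zcancel.
Qed.

Lemma ce_injX m k : ce_inj (m *+ k) = ce_inj m ^+ k.
Proof.
elim: k => [|k IHk]; first by rewrite mulr0n /ce_inj add0r.
by rewrite mulrS ce_injD IHk expgS.
Qed.

Lemma ce_kerP z : ce_proj z = 1 -> z = ce_inj (z.1 + val c (1, 1)).
Proof. by case: z => a g; rewrite /ce_proj /ce_inj /= addrK => ->. Qed.

End CentralExtension.

(** * Symmetric cocycles of abelian groups *)

Section AbelianSplitting.
Variable M : zmodType.
Hypothesis M_divisible : forall (m : M) k, (0 < k)%N -> exists w, w *+ k = m.

(** By divisibility, a lift of [x] to the central extension can be corrected to
    have the same order as [x]; its powers form a complement above [<[x]>]. *)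
Lemma cyclic_splitting (G : finGroupType) (c : Z2 M G) (x : G) :
  exists phi, forall y z, y \in <[x]> -> z \in <[x]> ->
    val c (y, z) = coboundary phi (y, z).
Proof.
pose E := central_ext c.
have ejE (e : E) j : (e ^+ j).2 = e.2 ^+ j.
  by elim: j => // j IHj; rewrite !expgS -IHj.
have [e e2 ek] : exists2 e : E, e.2 = x & e ^+ #[x] = 1.
  pose e0 : E := ce_sec c x.
  have /ce_kerP : ce_proj (e0 ^+ #[x]) = 1 by rewrite /ce_proj ejE expg_order.
  set m := _ + _ => e0k; have [w wk] := M_divisible (- m) (order_gt0 x).
  exists (ce_inj c w * e0); first by rewrite ce_mulE /= mul1g.
  rewrite expgMn; last exact: ce_ker_central.
  by rewrite -ce_injX e0k -ce_injD wk addNr /ce_inj add0r.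
pose s y := e ^+ odflt 0%N (omap val [pick j : 'I_#[x] | x ^+ j == y]).
have sE j : s (x ^+ j) = e ^+ j.
  have emod k : e ^+ k = e ^+ (k %% #[x]).
    by rewrite {1}(divn_eq k #[x]) expgnDr mulnC expgnA ek expg1n mul1g.
  rewrite /s; case: pickP => [k /eqP|] /=.
    move/eqP; rewrite eq_expg_mod_order => /eqP kj.
    by rewrite emod kj -emod.
  move/(_ (Ordinal (ltn_pmod j (order_gt0 x)))).
  by rewrite /= -expg_mod_order modn_mod expg_mod_order eqxx.
exists [ffun y => - (s y).1] => y z /cycleP[j ->] /cycleP[k ->].
rewrite coboundaryE !ffunE -expgD !sE expgnDr ce_mulE /= !ejE e2.
zcancel.
Qed.

(** This is the vanishing of Ext (G, M) for a divisible [M].  Split the cocycle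
    on a cyclic subgroup [<[x]>]; by symmetry, the normalised cocycle vanishes
    as soon as one argument is in [<[x]>], so that it descends to the smaller
    group [G / <[x]>]. *)
Lemma symmetric_coboundary (G : finGroupType) (c : Z2 M G) :
    (forall x y : G, commute x y) ->
    (forall x y, val c (x, y) = val c (y, x)) ->
  exists phi, val c = coboundary phi.
Proof.
have [n] := ubnP #|G|; elim: n G c => // n IHn G c Gn abG symc.
case: (pickP (fun x : G => x != 1)) => [x ntx | G1]; last first.
  exists [ffun=> val c (1, 1)]; apply/ffunP => -[x y].
  have all1 (z : G) : z = 1 by have /negbFE/eqP := G1 z.
  by rewrite coboundaryE !ffunE (all1 x) (all1 y) subrr add0r.
have nB y : y \in 'N(<[x]>).
  rewrite inE; apply/subsetP => _ /imsetP[z zx ->].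
  by rewrite conjgE (abG z) mulKg.
(* As [G] is abelian, the domain of the coset morphism is the whole of [G]. *)
have qM : {morph coset <[x]> : y z / y * z} by move=> y z; rewrite morphM.
pose q : {multiplicative G -> coset_of <[x]>} :=
  HB.pack (coset <[x]> : G -> coset_of <[x]>)
    (isMultiplicative.Build _ _ (coset <[x]>) qM).
have q_surj y : exists z, q z = y by have [z _ ->] := cosetP y; exists z.
have q_ker y : q y = 1 -> y \in <[x]> by apply: coset_idr.
have [phi phiP] := cyclic_splitting c x.
have [||d [psi dE]] := descend_class q_surj (c := c) (phi := phi).
- by move=> y z /q_ker yx /q_ker zx; apply: phiP.
- move=> psi /= h g b qb; rewrite -(h g b qb) !subr_coboundaryE symc abG.
  by rewrite (abG g b); zcancel.
have [|||chi chiE] := IHn _ d.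
- rewrite ltnS in Gn; apply: leq_trans Gn; rewrite -!cardsT -quotientT.
  by rewrite ltn_quotient ?subsetT ?cycle_eq1.
- move=> y z; have [y' <-] := q_surj y; have [z' <-] := q_surj z.
  by rewrite /commute -!gmulfM abG.
- move=> y z; have [y' <-] := q_surj y; have [z' <-] := q_surj z.
  by rewrite -!(Z2_mapE q d (_, _)) dE !subr_coboundaryE symc abG; zcancel.
apply/H2_eq0; rewrite -(H2_subr_coboundary c psi) -dE -H2_map_pi.
have -> : \pi_(H2 M (coset_of <[x]>)) d = 0 by apply/H2_eq0; exists chi.
by rewrite raddf0.
Qed.

End AbelianSplitting.

(** * The commutator map on the exterior square *)

Section CommutatorPairing.

Lemma lcommgMl (K : groupType) (a a' b : K) :
  lcommg (a * a') b = lcommg (lconjg a a') (lconjg a b) * lcommg a b.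
Proof. by rewrite /lcommg /lconjg !(invgM, invgK) !mulgA !mulgVK. Qed.

Lemma lcommgMr (K : groupType) (a b b' : K) :
  lcommg a (b * b') = lcommg a b * lcommg (lconjg b a) (lconjg b b').
Proof. by rewrite /lcommg /lconjg !(invgM, invgK) !mulgA !mulgVK. Qed.

Variables (E H : groupType) (q : {multiplicative E -> H}) (s : H -> E).
Hypothesis qK : forall h, q (s h) = h.
Hypothesis ker_central : forall z x, q z = 1 -> commute z x.

Lemma lcommg_central (a a' b b' : E) :
  q a = q a' -> q b = q b' -> lcommg a b = lcommg a' b'.
Proof.
have ker_div u v : q u = q v -> q (u * v^-1) = 1.
  by move=> uv; rewrite gmulfM Defs.mulfV uv mulgV.
move=> /ker_div; set z := a * _ => qz /ker_div; set w := b * _ => qw.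
have -> : a = z * a' by rewrite mulgVK.
have -> : b = w * b' by rewrite mulgVK.
move: z w qz qw => z w qz qw; rewrite /lcommg !invgM !mulgA.
have czk t : z * t * z^-1 = t by rewrite (ker_central t qz) mulgK.
have cwk t : w * t * w^-1 = t by rewrite (ker_central t qw) mulgK.
have -> : z * a' * w * b' * a'^-1 * z^-1 = a' * w * b' * a'^-1.
  by rewrite -[RHS]czk !mulgA.
by rewrite -(ker_central a' qw) -[RHS]cwk !mulgA.
Qed.

Lemma lcommg_sec (a b : E) x y :
  q a = x -> q b = y -> lcommg (s x) (s y) = lcommg a b.
Proof. by move=> <- <-; apply: lcommg_central; rewrite qK. Qed.

(** The relations of the exterior square are the identities satisfied by the
    commutators of the lifts. *)
Lemma wedge_commutator_map :
  exists f : {multiplicative exterior_square H -> E},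
    forall x y, f (wedge x y) = lcommg (s x) (s y).
Proof.
pose f0 : {multiplicative free_group (symbols H) -> E} :=
  fg_lift (fun r : symbols H => lcommg (s r.1) (s r.2)).
have f0E x y : f0 (symbol x y) = lcommg (s x) (s y) by exact: fg_lift_gen.
have f0_rel a : tensor_relator a -> f0 a = 1.
  case=> [g g' h|g h h']; rewrite gmulfM Defs.mulfV gmulfM !f0E.
    rewrite (@lcommg_sec (s g * s g') (s h) (g * g') h) ?gmulfM ?qK // lcommgMl.
    rewrite (@lcommg_sec (lconjg (s g) (s g')) (lconjg (s g) (s h))
      (lconjg g g') (lconjg g h));
      by rewrite ?mulf_conj ?qK ?mulgV.
  rewrite (@lcommg_sec (s g) (s h * s h') g (h * h')) ?gmulfM ?qK // lcommgMr.
  rewrite (@lcommg_sec (lconjg (s h) (s g)) (lconjg (s h) (s h'))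
    (lconjg h g) (lconjg h h'));
    by rewrite ?mulf_conj ?qK ?mulgV.
pose f1 : {multiplicative tensor_square H -> E} := nq_lift f0_rel.
have f1E x y : f1 (tensor x y) = lcommg (s x) (s y).
  by rewrite [LHS]nq_lift_proj f0E.
have f1_diag a : tensor_diag a -> f1 a = 1.
  by case=> g; rewrite f1E /lcommg mulgK mulgV.
exists (nq_lift f1_diag) => x y; exact: (etrans (nq_lift_proj f1_diag _)).
Qed.

End CommutatorPairing.

(** * Cocycles of the Bogomolov multiplier *)

Definition symmetric_on_commuting (M : zmodType) (G : finGroupType)
    (c : Z2 M G) :=
  forall x y, commute x y -> val c (x, y) = val c (y, x).

Lemma lcommg_eq1 (G : groupType) (x y : G) : lcommg x y = 1 <-> commute x y.
Proof.
rewrite /lcommg /commute; split=> [h|->]; last by rewrite mulgK mulgV.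
by rewrite -[RHS]mul1g -h !mulgA !mulgVK.
Qed.

(** The wedge of commuting [x] and [y] is the image of an element of the
    subgroup generated by the wedges of commuting pairs of [G]; the images in
    [H] of such a pair have commuting lifts by the symmetry of the inflation. *)
Lemma symmetric_on_commuting_descent (M : zmodType) (G H : finGroupType)
    (p : {multiplicative G -> H}) (d : Z2 M H) :
    (forall w : M0 H, exists v : M0 G, M0_map p v = w) ->
  symmetric_on_commuting (Z2_map p d) -> symmetric_on_commuting d.
Proof.
move=> M0_epi symG x y xy.
have [f fE] := @wedge_commutator_map (central_ext d) H (@ce_proj M H d)
  (ce_sec d) (fun=> erefl) (@ce_ker_central M H d).
have M0w : wedge x y \in @M0_pred H.
  by apply/asboolP/gen_mem/Commuting_wedge/lcommg_eq1.
have [v /(congr1 val) /= vE] := M0_epi (MkM0 M0w).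
have f1 : f (exterior_map p (val v)) = 1.
  have /asboolP := valP v.
  elim=> {v vE} [_ [g h /lcommg_eq1 gh]||a b _ fa _ fb|a _ fa].
  - rewrite exterior_mapE fE; apply/lcommg_eq1/ce_sec_commute.
      by rewrite /commute -!gmulfM gh.
    by have := symG g h gh; rewrite !Z2_mapE.
  - by rewrite !mulf1.
  - by rewrite !gmulfM fa fb mulg1.
  - by rewrite !Defs.mulfV fa invg1.
by move: f1; rewrite vE fE => /lcommg_eq1/ce_sec_commute; apply.
Qed.

Lemma QmodZ_divisible (m : QmodZ) k : (0 < k)%N -> exists w, w *+ k = m.
Proof.
move=> k0; exists (\pi_QmodZ (repr m / k%:R)%R).
rewrite -raddfMn /= -[(_ / _ *+ k)%R]mulr_natr mulfVK ?reprK //.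
by rewrite Num.Theory.pnatr_eq0 -lt0n.
Qed.

(** A coboundary of an abelian group is symmetric, and two commuting elements
    generate an abelian subgroup; the converse is [symmetric_coboundary] on each
    abelian subgroup. *)
Lemma B0_piP (G : finGroupType) (c : Z2 QmodZ G) :
  \pi_(H2 QmodZ G) c \in @B0_pred G <-> symmetric_on_commuting c.
Proof.
split=> [/B0_predP cB x y xy|symc]; last first.
  apply/B0_predP => A abA; rewrite /H2_res H2_map_pi; apply/H2_eq0.
  have abA' (x y : [subg A]) : commute x y.
    by apply/val_inj/(centsP abA); apply: subgP.
  apply: (symmetric_coboundary QmodZ_divisible abA') => x y.
  by rewrite !Z2_mapE; apply: symc; rewrite /commute -!gmulfM abA'.
have abS : abelian <<[set x; y]>>.
  by rewrite abelian_gen; apply/centsP => _ /set2P[] -> _ /set2P[] ->.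
have := cB _ abS; rewrite /H2_res H2_map_pi => /H2_eq0[phi /ffunP phiE].
have Sx : x \in <<[set x; y]>> by rewrite mem_gen ?set21.
have Sy : y \in <<[set x; y]>> by rewrite mem_gen ?set22.
have := phiE (Subg Sx, Subg Sy); have := phiE (Subg Sy, Subg Sx).
rewrite !Z2_mapE !coboundaryE /=.
have -> : Subg Sx * Subg Sy = Subg Sy * Subg Sx by apply: val_inj.
by move=> -> ->; zcancel.
Qed.

(** * Extensions with a perfect kernel *)

Section PerfectKernel.

Lemma perfect_to_zmod (N : finGroupType) (M : zmodType) (f : N -> M) :
    [~: [set: N], [set: N]] = [set: N] ->
    (forall x y, f (x * y) = f x + f y) ->
  forall x, f x = 0.
Proof.
move=> perfN fM.
have f1 : f 1 = 0 by have h := fM 1 1; rewrite mulg1 in h; zcancel_by (esym h).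
have fV x : f x^-1 = - f x.
  by have h := fM x x^-1; rewrite mulgV f1 in h; zcancel_by (esym h).
have kerP : group_set [set x | f x == 0].
  apply/group_setP; split=> [|x y]; rewrite !inE ?f1 //.
  by move=> /eqP fx /eqP fy; rewrite fM fx fy addr0.
have : [~: [set: N], [set: N]] \subset Group kerP.
  rewrite gen_subG; apply/subsetP => _ /imset2P[x y _ _ ->].
  by rewrite inE /commg /conjg !fM !fV; apply/eqP; zcancel.
by rewrite perfN => /subsetP sN x; have := sN x; rewrite !inE => /(_ isT)/eqP.
Qed.

Variables (M : zmodType) (N G H : finGroupType).
Variables (i : {multiplicative N -> G}) (p : {multiplicative G -> H}).
Hypothesis exact_G : forall g : G, p g = 1 <-> exists n : N, i n = g.
Hypothesis p_surj : forall h : H, exists g : G, p g = h.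
Hypothesis N_perfect : [~: [set: N], [set: N]] = [set: N].

Lemma kernel_image n : p (i n) = 1.
Proof. by apply/exact_G; exists n. Qed.

(** A cochain of [G] whose coboundary is inflated from [H] is a homomorphism on
    [N] up to a constant, hence constant on the cosets of [N]. *)
Lemma inflation_inj (d : Z2 M H) :
  \pi_(H2 M G) (Z2_map p d) = 0 -> \pi_(H2 M H) d = 0.
Proof.
move=> /H2_eq0[phi /ffunP phiE]; apply/H2_eq0.
have dE g h : val d (p g, p h) = phi h - phi (g * h) + phi g.
  by rewrite -coboundaryE -phiE Z2_mapE.
have phiN n : phi (i n) = val d (1, 1).
  apply/eqP; rewrite -subr_eq0; apply/eqP; move: n.
  apply: perfect_to_zmod N_perfect _ => m n.
  have := dE (i m) (i n); rewrite !kernel_image -gmulfM => h.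
  zcancel_by h.
have phi_ker g n : p n = 1 -> phi (g * n) = phi g.
  move=> pn; have [n' nE] := proj1 (exact_G n) pn.
  have := dE g n; rewrite pn cocyclex1 -nE phiN => h.
  zcancel_by h.
have s_ex h : {g | p g = h} by apply: cid.
pose s h := sval (s_ex h).
have ps h : p (s h) = h := svalP (s_ex h).
have phis g : phi (s (p g)) = phi g.
  rewrite -[in RHS](mulVKg (s (p g)) g) phi_ker //.
  by rewrite gmulfM Defs.mulfV ps mulVg.
exists [ffun h => phi (s h)]; apply/ffunP => -[x y].
have [g <-] := p_surj x; have [h <-] := p_surj y.
by rewrite coboundaryE !ffunE -gmulfM !phis dE.
Qed.

Lemma restriction_inflation (d : Z2 M H) :
  \pi_(H2 M N) (Z2_map i (Z2_map p d)) = 0.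
Proof.
apply/H2_eq0; exists [ffun=> val d (1, 1)]; apply/ffunP => -[x y].
by rewrite !Z2_mapE coboundaryE !ffunE !kernel_image subrr add0r.
Qed.

(** For a cocycle [c'] with [c' (g, n) = 0] for [n] in the kernel, the map
    [n |-> c' (n, g)] is a homomorphism, which vanishes as [N] is perfect. *)
Lemma inflation_exact (c : Z2 M G) :
    injective i -> \pi_(H2 M N) (Z2_map i c) = 0 ->
  exists d : Z2 M H, exists psi, Z2_map p d = c - coboundary_Z2 psi.
Proof.
move=> i_inj /H2_eq0[phi /ffunP phiE].
pose phiG := [ffun g => if [pick n | i n == g] is Some n then phi n else 0].
have phiGi n : phiG (i n) = phi n.
  rewrite ffunE; case: pickP => [m /eqP/i_inj->//|/(_ n)].
  by rewrite eqxx.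
apply: (descend_class p_surj (phi := phiG)).
  move=> _ _ /exact_G[m <-] /exact_G[n <-].
  by rewrite coboundaryE -gmulfM !phiGi -coboundaryE -phiE Z2_mapE.
move=> psi c' c'0 g _ /exact_G[n <-]; move: n.
apply: perfect_to_zmod N_perfect _ => m n.
have h := cocycleE c' (i m) (i n) g.
have h2 := cocycleE c' (i m) g (i n ^ g).
have png : p (i n ^ g) = 1.
  by rewrite /conjg !gmulfM kernel_image mul1g -gmulfM mulVg mulf1.
rewrite -conjgC !(c'0 _ _ png) !add0r in h2.
rewrite (c'0 _ _ (kernel_image n)) addr0 h2 in h.
by rewrite gmulfM -h addrC.
Qed.

End PerfectKernel.

Theorem proposition6p1
  (N G H : finGroupType)
  (i : {multiplicative N -> G}) (p : {multiplicative G -> H})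
  (i_inj : injective i)
  (exact_G : forall g : G, p g = 1 <-> exists n : N, i n = g)
  (p_surj : forall h : H, exists g : G, p g = h)
  (N_perfect : [~: [set: N], [set: N]] = [set: N])
  (M0_epi : forall w : M0 H, exists v : M0 G, M0_map p v = w) :
  injective (B0_map p) /\
  (forall b : B0 G, B0_map i b = 0%R <-> exists a : B0 H, B0_map p a = b).
Proof.
split=> [|b].
  apply: raddf_inj => a /(congr1 val) /= pa0; apply: val_inj.
  rewrite raddf0 -[val a]reprK.
  apply: (inflation_inj exact_G p_surj N_perfect).
  by rewrite -H2_map_pi reprK.
split=> [ib0|[a <-]].
  have iN0 : \pi_(H2 QmodZ N) (Z2_map i (repr (val b))) = 0.
    by rewrite -H2_map_pi reprK; have := congr1 val ib0; rewrite raddf0.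
  have [d [psi dE]] := inflation_exact exact_G p_surj N_perfect i_inj iN0.
  have pd : H2_map p (\pi_(H2 QmodZ H) d) = val b.
    by rewrite H2_map_pi dE H2_subr_coboundary reprK.
  have dB0 : \pi_(H2 QmodZ H) d \in @B0_pred H.
    apply/B0_piP/(symmetric_on_commuting_descent M0_epi)/B0_piP.
    by rewrite -H2_map_pi pd; apply: valP.
  by exists (MkB0 dB0); apply: val_inj.
apply: val_inj; rewrite raddf0 /= -[val a]reprK !H2_map_pi.
exact: restriction_inflation.
Qed.
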